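(* Let $X$ be an index set, $R\subset\mathbb{R}^m$, and $\mathcal{P}=\{\mathcal{P}_{x,r}:x\in X,r\in R\}$ a family of finite subsets of $\mathbb{R}^n$. For $B\subset\mathbb{R}^n$ let $S(B,\mathcal{P})=\{r\in R:\mathcal{P}_{x,r}\subset B\text{ for some }x\in X\}$. Suppose there is a constant $c>0$ such that for every bounded $B\subset\mathbb{R}^n$, $\dim_M B\ge c\cdot\dim_M S(B,\mathcal{P})$. Then for every $B'\subset\mathbb{R}^n$, $\dim_P B'\ge c\cdot\dim_P S(B',\mathcal{P})$.
   Context: $\dim_M$ is Minkowski (upper box) dimension and $\dim_P$ is packing dimension, $\dim_P E=\inf\{\sup_j\dim_M E_j: E\subset\bigcup_j E_j\}$. *)

(* Defs.v *)
From HB Require Import structures.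
From mathcomp Require Import all_boot all_order all_algebra.
From mathcomp Require Import all_classical all_reals all_analysis.

Set Implicit Arguments.
Unset Strict Implicit.
Unset Printing Implicit Defensive.

Import Order.TTheory GRing.Theory Num.Theory.
Import numFieldNormedType.Exports.

Local Open Scope classical_set_scope.
Local Open Scope ring_scope.

(* R^n is ['rV[R]_n]. Its library norm is the sup norm, so a closed ball of
   radius d is an axis-parallel cube of side 2d. *)

(* Least number of such cubes covering E; it is +oo if no finite number of
   them suffices, that is, if E is unbounded. *)
Definition covering_number (R : realType) (n : nat) (E : set 'rV[R]_n) (d : R)
    : \bar R :=
  ereal_inf [set (k%:R)%:E | k in
    [set k : nat | exists a : 'I_k -> 'rV[R]_n,
       E `<=` \bigcup_(i in [set: 'I_k]) closed_ball (a i) d]].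

(* limsup of log N(E, d) / (- log d) as d tends to 0 from the right. The
   formula gives +oo on unbounded sets. The empty set, for which it would give
   -oo, has dimension 0 by convention. *)
Definition minkowski_dim (R : realType) (n : nat) (E : set 'rV[R]_n) : \bar R :=
  if E == set0 then 0%E
  else limf_esup (fun d : R => lne (covering_number E d) * ((- ln d)^-1)%:E)%E
                 (0 : R)^'+.

Definition packing_dim (R : realType) (n : nat) (E : set 'rV[R]_n) : \bar R :=
  ereal_inf [set ereal_sup (range (fun j => minkowski_dim (F j))) | F in
    [set F : nat -> set 'rV[R]_n | E `<=` \bigcup_j F j]].

Definition contained_params (R : realType) (m n : nat) (X : Type)
    (T : set 'rV[R]_m) (P : X -> 'rV[R]_m -> set 'rV[R]_n)
    (B : set 'rV[R]_n) : set 'rV[R]_m :=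
  [set r | T r /\ exists x : X, P x r `<=` B].

(* Main.v *)
Require Import Defs.
From mathcomp Require Import all_boot all_order all_algebra.
From mathcomp Require Import all_classical all_reals all_analysis.
Import Order.TTheory GRing.Theory Num.Theory.
Import numFieldNormedType.Exports.
Local Open Scope classical_set_scope.
Local Open Scope ring_scope.

(** Given a countable cover [F] of [B'], the partial unions
    [G k = F 0 `|` ... `|` F k] increase, so each finite configuration contained
    in [B'] is contained in some [G k]. Hence the sets [S(G k)] cover [S(B')].
    Minkowski dimension is finitely stable, so [dim_M (G k)] is at most the
    supremum of the [dim_M (F j)], and if that supremum is finite then [G k] is
    bounded and the hypothesis applies to it. *)

(** It is enough to test real upper bounds: they approach a finite [y] from above, and if [y] is -oo
    they push [x] below every real. *)
Lemma lee_EFin_gt (R : realType) (x y : \bar R) :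
  (forall r : R, (y < r%:E)%E -> (x <= r%:E)%E) -> (x <= y)%E.
Proof.
case: y => [y| |] H; last 2 first.
- by rewrite leey.
- case: x H => [x| |] H //.
  + have := H (x - 1) (ltNyr _).
    by rewrite lee_fin leNgt ltrBlDr ltrDl ltr01.
  + by have := H 0 (ltNyr _).
apply/lee_addgt0Pr => e e0.
by apply: H; rewrite lte_fin ltrDl.
Qed.

Section limf_esup_near.
Context {T : choiceType} {X : filteredType T} {R : realType}.
Variables (f : X -> \bar R) (F : set_system X).
Hypothesis FF : Filter F.

(** The limsup is an infimum of suprema over the sets of the filter, so a strict bound on it is
    attained on one such set. *)
Lemma limf_esup_lt (x : \bar R) :
  (limf_esup f F < x)%E -> \forall z \near F, (f z < x)%E.
Proof.
move=> /ereal_inf_lt[_ [V FV <-] supVx].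
apply: filterS FV => z Vz.
by apply: le_lt_trans supVx; apply: ereal_sup_ubound; exists z.
Qed.

Lemma limf_esup_le (x : \bar R) :
  (\forall z \near F, (f z <= x)%E) -> (limf_esup f F <= x)%E.
Proof.
move=> Ffx; apply: (@le_trans _ _ (ereal_sup (f @` [set z | (f z <= x)%E]))).
  by apply: ereal_inf_lbound; exists [set z | (f z <= x)%E].
by apply: ge_ereal_sup => _ [z fzx <-].
Qed.

End limf_esup_near.

Section lne_expR.
Variable R : realType.
Implicit Types (x : \bar R) (a : R).

(** On nonpositive reals [lne] is -oo, but these lie below [expR a] anyway. *)
Lemma lne_lt_EFin x a : (lne x < a%:E)%E -> (x < (expR a)%:E)%E.
Proof.
case: x => [x| |] //=; last by rewrite !ltNyr.
have [x0 _|x0] := leP x 0; first by rewrite lte_fin (le_lt_trans x0) ?expR_gt0.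
by rewrite !lte_fin => xa; rewrite -(lnK x0) ltr_expR.
Qed.

Lemma lne_le_EFin x a : (x <= (expR a)%:E)%E -> (lne x <= a%:E)%E.
Proof.
case: x => [x| |] //=; last by rewrite !leNye.
have [x0 _|x0] := leP x 0; first by rewrite leNye.
by rewrite !lee_fin => xa; rewrite -ler_expR lnK.
Qed.

End lne_expR.

Section minkowski.
Variables (R : realType) (n : nat).
Implicit Types (A B E : set 'rV[R]_n) (d r : R).

Lemma covering_number_lt E d (x : \bar R) : (covering_number E d < x)%E ->
  exists k (a : 'I_k -> 'rV[R]_n), ((k%:R)%:E < x)%E /\
    E `<=` \bigcup_(i in [set: 'I_k]) closed_ball (a i) d.
Proof. by move=> /ereal_inf_lt[_ [k [a Ea] <-] kx]; exists k, a. Qed.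

(** The strict bounds on the two infima yield actual finite covers, which are then concatenated. *)
Lemma covering_numberU_le A B d (x y : R) :
  (covering_number A d < x%:E)%E -> (covering_number B d < y%:E)%E ->
  (covering_number (A `|` B) d <= (x + y)%:E)%E.
Proof.
move=> /covering_number_lt[k [a [kx Aa]]] /covering_number_lt[l [b [lx Bb]]].
apply: (@le_trans _ _ ((k + l)%:R)%:E); last first.
  by rewrite lee_fin natrD lerD// -lee_fin ltW.
apply: ereal_inf_lbound; exists (k + l)%N => //=.
exists (fun i => match fintype.split i with inl i => a i | inr i => b i end).
move=> z [/Aa[i _ zi]|/Bb[i _ zi]].
- by exists (lshift l i) => //; rewrite (unsplitK (inl i)).
- by exists (rshift k i) => //; rewrite (unsplitK (inr i)).
Qed.

(** As [expR (r * - ln d)] is d^(-r), this is the counting form of a dimension bound. *)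
Lemma minkowski_dim_lt E r : E !=set0 -> (minkowski_dim E < r%:E)%E ->
  \forall d \near 0^'+, (covering_number E d < (expR (r * - ln d))%:E)%E.
Proof.
move=> /set0P/negPf E0; rewrite /minkowski_dim E0 => /limf_esup_lt dimE.
near=> d.
(* For d < 1 the divisor - ln d is positive and can be cleared. *)
have d1 : 0 < - ln d.
  rewrite oppr_gt0 ln_lt0//; apply/andP; split; first by near: d; exact: nbhs_right_gt.
  by near: d; exact: nbhs_right_lt.
apply: lne_lt_EFin; rewrite EFinM -lte_pdivrMr//.
by near: d; exact: dimE.
Unshelve. all: by end_near. Qed.

(** The two covers together use at most 2 d^(-r) cubes; for small d the factor 2 is absorbed by
    d^(-e), with e > 0 arbitrary. *)
Lemma minkowski_dimU_le A B r : A !=set0 -> B !=set0 ->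
  (minkowski_dim A < r%:E)%E -> (minkowski_dim B < r%:E)%E ->
  (minkowski_dim (A `|` B) <= r%:E)%E.
Proof.
move=> A0 B0 Ar Br.
have AB0 : (A `|` B == set0) = false.
  by apply/negbTE/set0P; case: A0 => a Aa; exists a; left.
apply/lee_addgt0Pr => e e0; rewrite /minkowski_dim AB0.
apply: limf_esup_le; near=> d.
(* Equivalently, 2 < d^(-e). *)
have d1 : ln 2 / e < - ln d.
  rewrite ltrNr; near: d.
  by have /cvgrNyPlt := @lnNy R; apply.
have ln2 : 0 <= ln (2 : R) by rewrite ln_ge0// ler1n.
have d0 : 0 < - ln d by apply: le_lt_trans d1; rewrite divr_ge0// ltW.
rewrite lee_pdivrMr// -EFinD -EFinM; apply: lne_le_EFin.
apply: (@le_trans _ _ (expR (r * - ln d) + expR (r * - ln d))%:E).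
  apply: covering_numberU_le; near: d; exact: minkowski_dim_lt.
rewrite lee_fin -mulr2n -mulr_natl [(r + e) * _]mulrDl expRD mulrC ler_wpM2l ?expR_ge0//.
by rewrite -[leLHS]lnK ?posrE// ler_expR mulrC -ler_pdivrMr// ltW.
Unshelve. all: by end_near. Qed.

Lemma minkowski_dimU A B :
  (minkowski_dim (A `|` B) <= maxe (minkowski_dim A) (minkowski_dim B))%E.
Proof.
(* The dimension of the empty set is a convention, so empty sets are treated before limsups are
   compared. *)
have [->|A0] := eqVneq A set0; first by rewrite set0U le_max lexx orbT.
have [->|B0] := eqVneq B set0; first by rewrite setU0 le_max lexx.
apply: lee_EFin_gt => r; rewrite gt_max => /andP[Ar Br].
by apply: minkowski_dimU_le => //; exact/set0P.
Qed.

Lemma minkowski_dim_bigcup (F : nat -> set 'rV[R]_n) k :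
  (minkowski_dim (\bigcup_(j < k.+1) F j) <=
     ereal_sup (range (fun j => minkowski_dim (F j))))%E.
Proof.
elim: k => [|k IHk]; rewrite bigcup_mkord big_ord_recr/=.
  by rewrite big_ord0 set0U; apply: ereal_sup_ubound; exists 0%N.
apply: le_trans (minkowski_dimU _ _) _.
rewrite ge_max -bigcup_mkord IHk/=.
by apply: ereal_sup_ubound; exists k.+1.
Qed.

(** A finite dimension forces a finite cover by cubes at some small radius. *)
Lemma bounded_minkowski_dim E : (minkowski_dim E < +oo)%E -> bounded_set E.
Proof.
have [->|/set0P E0] := eqVneq E set0.
  by move=> _; exists 0; split => // M _ x.
move=> Eoo.
have [r Er] : exists r : R, (minkowski_dim E < r%:E)%E.
  case: (minkowski_dim E) Eoo => [x| |] // _; last by exists 0; rewrite ltNyr.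
  by exists (x + 1); rewrite lte_fin ltrDl.
near (0 : R)^'+ => d.
have d0 : 0 < d by near: d; exact: nbhs_right_gt.
have /covering_number_lt[k [a [_ Ea]]] :
    (covering_number E d < (expR (r * - ln d))%:E)%E.
  by near: d; exact: minkowski_dim_lt.
(* The sum dominates the norm of each centre, and [d] bounds the distance to it. *)
exists (\sum_i `|a i| + d); split; first exact: num_real.
move=> M /ltW leM x /Ea[i _]; rewrite closed_ballE// /closed_ball_/= => xi.
apply: le_trans leM.
apply: (@le_trans _ _ (`|a i| + `|a i - x|)).
  by rewrite -{1}(subKr (a i) x) (le_trans (ler_normB _ _)).
by rewrite lerD// (bigD1 i)//= lerDl sumr_ge0.
Unshelve. all: by end_near. Qed.

End minkowski.

(** Each element lies in some [F j]; finitely many such indices have a maximum. *)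
Lemma finite_set_bigcup_sub (T : choiceType) (A : set T) (F : nat -> set T) :
  finite_set A -> A `<=` \bigcup_j F j ->
  exists k, A `<=` \bigcup_(j < k.+1) F j.
Proof.
move=> /finite_seqP[s ->]; elim: s => [|x s IHs] sF; first by exists 0%N.
have [|k sk] := IHs; first by move=> y /= ys; apply: sF; rewrite /= inE ys orbT.
have [j _ Fj] : (\bigcup_j F j) x by apply: sF; rewrite /= mem_head.
exists (maxn j k) => y /=; rewrite inE => /orP[/eqP ->|/sk[i ik Fi]].
- by exists j => //=; rewrite ltnS leq_maxl.
- by exists i => //=; rewrite (leq_trans ik)// ltnS leq_maxr.
Qed.

Theorem mainTheorem10 (R : realType) (m n : nat) (X : Type)
    (T : set 'rV[R]_m) (P : X -> 'rV[R]_m -> set 'rV[R]_n)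
    (finP : forall (x : X) (r : 'rV[R]_m), T r -> finite_set (P x r))
    (c : R) (c_gt0 : 0 < c)
    (dimM_ge : forall B : set 'rV[R]_n, bounded_set B ->
       (c%:E * minkowski_dim (contained_params T P B) <= minkowski_dim B)%E) :
  forall B' : set 'rV[R]_n,
    (c%:E * packing_dim (contained_params T P B') <= packing_dim B')%E.
Proof.
move=> B; apply: le_ereal_inf_tmp => _ [F BF <-].
set s := ereal_sup _.
have [->|s_neqy] := eqVneq s +oo%E; first by rewrite leey.
pose G k := \bigcup_(j < k.+1) F j.
have Gs k : (minkowski_dim (G k) <= s)%E by exact: minkowski_dim_bigcup.
(* Moving [c] to the right leaves the packing dimension alone on the left, where any single cover
   bounds it. *)
rewrite -lee_pdivlMl//.
apply: (@le_trans _ _ (ereal_sup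
    (range (fun k => minkowski_dim (contained_params T P (G k)))))).
  apply: ereal_inf_lbound; exists (fun k => contained_params T P (G k)) => //=.
  move=> r [Tr [x PB]].
  (* Finiteness of [P x r] places the whole configuration in one partial union. *)
  have [k Pk] := @finite_set_bigcup_sub _ _ F (finP x r Tr) (subset_trans PB BF).
  by exists k => //; split => //; exists x.
apply: ge_ereal_sup => _ [k _ <-]; rewrite lee_pdivlMl//.
(* Since [s] is not +oo, [G k] has finite dimension and is therefore bounded. *)
apply: le_trans (Gs k); apply/dimM_ge/bounded_minkowski_dim.
by rewrite (le_lt_trans (Gs k))// ltey.
Qed.
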